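(* For every real $r$ with $0\le r<\frac13$, $\pi_1(S^1,c_r)\cong\mathbb{Z}$.
   Context: A Čech closure space $(X,c)$ is a set $X$ with a map $c:\mathcal{P}(X)\to\mathcal{P}(X)$ such that $c(\emptyset)=\emptyset$, $A\subseteq c(A)$, and $c(A\cup B)=c(A)\cup c(B)$ (not assumed $c^2=c$). A topological space is a closure space via its topological closure. A map $f:(X,c_X)\to(Y,c_Y)$ is continuous iff $f(c_X(A))\subseteq c_Y(f(A))$ for all $A\subseteq X$. $U$ is a neighborhood of $x$ if $x\in X\setminus c(X\setminus U)$. The product closure structure on $X\times Y$ is the one in which, at each point $(x,y)$, the sets $V\times W$ ($V$ a neighborhood of $x$, $W$ a neighborhood of $y$) form a local base of neighborhoods. For a metric space $(X,d)$ and $r\ge 0$, $c_r(A)=\{x\in X\mid d(x,A)\le r\}$, where $d(x,A)=\inf_{y\in A}d(x,y)$ (and $c_r(\emptyset)=\emptyset$). $S^1=\mathbb{R}/\mathbb{Z}$ is the circle of circumference $1$ with the quotient metric $d([x],[y])=\min_{k\in\mathbb{Z}}|x-y+k|$. $I=[0,1]$ has its usual topology. $\pi_1(X,* )$ is the group of homotopy classes rel $\partial I$ of continuous loops $v:I\to(X,c)$ based at $*$ (homotopies are continuous maps $I\times I\to (X,c)$ fixed on $\partial I$), with product $[v][w]=[v\star w]$ given by concatenation; the basepoint is suppressed from the notation. *)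

(* Defs.v *)
From HB Require Import structures.
From mathcomp Require Import all_boot all_order all_algebra generic_quotient.
From mathcomp Require Import all_classical all_reals topology normedtype.
From mathcomp Require Import lra.

Set Implicit Arguments.
Unset Strict Implicit.
Unset Printing Implicit Defensive.

Import Order.TTheory GRing.Theory Num.Theory.
Import numFieldNormedType.Exports.

Local Open Scope classical_set_scope.
Local Open Scope ring_scope.
Local Open Scope quotient_scope.

(* Cech closure spaces; closure spaces are passed explicitly since the same
   carrier is used with several closure operators. *)
Record closureSpace := ClosureSpace {
  carrier :> Type;
  cl : set carrier -> set carrier;
  cl0 : cl set0 = set0;
  sub_cl : forall A, A `<=` cl A;
  clU : forall A B, cl (A `|` B) = cl A `|` cl B
}.
Arguments cl {c}.

Definition cnbhd (X : closureSpace) (x : X) (U : set X) : Prop :=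
  (~` cl (~` U)) x.

Definition ccontinuous (X Y : closureSpace) (f : X -> Y) : Prop :=
  forall A : set X, f @` cl A `<=` cl (f @` A).

Section cnbhd_theory.
Context {X : closureSpace}.
Implicit Types (x : X) (A U V : set X).

Lemma cl_sub A U : A `<=` U -> cl A `<=` cl U.
Proof. by move=> /setUidPr <-; rewrite clU => x; left. Qed.

Lemma cnbhd_self x U : cnbhd x U -> U x.
Proof. by move=> h; apply: contrapT => nU; apply: h; exact: sub_cl. Qed.

Lemma cnbhdT x : cnbhd x setT.
Proof. by rewrite /cnbhd /= setCT cl0. Qed.

Lemma cnbhdS x U V : U `<=` V -> cnbhd x U -> cnbhd x V.
Proof. by move=> UV h /= ?; apply: h; apply: (cl_sub (subsetC UV)). Qed.

Lemma cnbhdI x U V : cnbhd x U -> cnbhd x V -> cnbhd x (U `&` V).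
Proof. by move=> hU hV; rewrite /cnbhd /= setCI clU => -[]. Qed.

Lemma clP A x : cl A x <-> ~ cnbhd x (~` A).
Proof. by rewrite /cnbhd /= setCK; split => [? //|/contrapT]. Qed.

End cnbhd_theory.
Arguments cnbhdT {X} x.

Lemma ccontinuousP (X Y : closureSpace) (f : X -> Y) :
  ccontinuous f <-> forall x U, cnbhd (f x) U -> cnbhd x (f @^-1` U).
Proof.
split=> [fc x U fU /= h|fc A _ [x Ax <-]].
  apply: fU; have /fc : (f @` cl (~` (f @^-1` U))) (f x) by exists x.
  by apply: cl_sub => _ [y nU <-].
apply/clP => /fc h; move/clP: Ax; apply; apply: cnbhdS h => y /= nfA Ay.
by apply: nfA; exists y.
Qed.

Section topological_closure_space.
Context (T : topologicalType).

Definition topo_cspace : closureSpace :=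
  @ClosureSpace T closure (@closure0 T) (@subset_closure T) (@closureU T).

Lemma topo_cnbhdE (x : T) (U : set T) :
  @cnbhd topo_cspace x U <-> nbhs x U.
Proof. by rewrite -[U in nbhs x U]setCK -[nbhs x _]/((~` ~` U)^° x) interiorC. Qed.

End topological_closure_space.

Section product_closure_space.
Context (X Y : closureSpace).

Definition prod_cl (A : set (X * Y)) : set (X * Y) := [set p |
  forall V W, cnbhd p.1 V -> cnbhd p.2 W -> (V `*` W) `&` A !=set0].

Lemma prod_cl0 : prod_cl set0 = set0.
Proof.
rewrite -subset0 => p /(_ setT setT (cnbhdT p.1) (cnbhdT p.2)).
by rewrite setI0 => -[].
Qed.

Lemma sub_prod_cl A : A `<=` prod_cl A.
Proof. by move=> p Ap V W /cnbhd_self ? /cnbhd_self ?; exists p. Qed.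

Lemma prod_clU A B : prod_cl (A `|` B) = prod_cl A `|` prod_cl B.
Proof.
rewrite eqEsubset; split=> p; last first.
  by case=> h V W nV nW; have [q [? ?]] := h V W nV nW; exists q; split=> //;
    [left|right].
move=> h; apply: contrapT => /not_orP[].
move=> /existsNP[V1 /existsNP[W1 /not_implyP[nV1 /not_implyP[nW1 h1]]]].
move=> /existsNP[V2 /existsNP[W2 /not_implyP[nV2 /not_implyP[nW2 h2]]]].
have [q [[[q1 q2] [q3 q4]] [Aq|Bq]]] :=
    h _ _ (cnbhdI nV1 nV2) (cnbhdI nW1 nW2).
  by apply: h1; exists q.
by apply: h2; exists q.
Qed.

Definition prod_cspace : closureSpace :=
  ClosureSpace prod_cl0 sub_prod_cl prod_clU.

(* Products of neighborhoods form a local base at each point, which determines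
   prod_cl because a closure operator is determined by its neighborhoods
   (lemma clP). *)
Lemma prod_cnbhdP (p : X * Y) (U : set (X * Y)) :
  @cnbhd prod_cspace p U <->
  exists V W, [/\ cnbhd p.1 V, cnbhd p.2 W & V `*` W `<=` U].
Proof.
split=> [|[V [W [nV nW VWU]]] /= h].
  move=> /existsNP[V /existsNP[W /not_implyP[nV /not_implyP[nW h]]]].
  exists V, W; split=> // q VWq; apply: contrapT => nU.
  by apply: h; exists q.
by have [q [/VWU Uq]] := h V W nV nW; apply.
Qed.

End product_closure_space.

Section metric_closure_space.
Context (R : realType) (M : metricType R) (r : R).

(* c_r; the first clause is needed because [inf set0 = 0]. *)
Definition metric_cl (A : set M) : set M :=
  [set x | A !=set0 /\ inf [set mdist x y | y in A] <= r].

Lemma metric_clP A x : metric_cl A x <->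
  forall e, 0 < e -> exists2 y, A y & mdist x y < r + e.
Proof.
have lb (B : set M) : has_lbound [set mdist x y | y in B].
  by exists 0 => _ [y _ <-]; exact: mdist_ge0.
split=> [[[a Aa] h] e e0|h].
  have hinf : has_inf [set mdist x y | y in A].
    by split; [exists (mdist x a); exists a|exact: lb].
  have [_ [y Ay <-] lty] := inf_adherent e0 hinf.
  by exists y => //; apply: lt_le_trans lty _; rewrite lerD2r.
split; first by have [y Ay _] := h 1 ltr01; exists y.
apply/ler_addgt0Pr => e e0; have [y Ay /ltW] := h e e0; apply: le_trans.
by apply: ge_inf => //; exists y.
Qed.

Lemma metric_cl0 : metric_cl set0 = set0.
Proof. by rewrite -subset0 => x [[]]. Qed.

Lemma metric_clU A B : metric_cl (A `|` B) = metric_cl A `|` metric_cl B.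
Proof.
rewrite eqEsubset; split=> x; last first.
  by case=> /metric_clP h; apply/metric_clP => e /h[y ? ?]; exists y => //;
    [left|right].
move=> /metric_clP h; apply: contrapT => /not_orP[/metric_clP + /metric_clP].
move=> /existsNP[e1 /not_implyP[e10 n1]] /existsNP[e2 /not_implyP[e20 n2]].
have [|y [Ay|By]] := h (Num.min e1 e2).
- by rewrite lt_min e10.
- move=> lty; apply: n1; exists y => //; apply: lt_le_trans lty _.
  by rewrite lerD2l ge_min lexx.
- move=> lty; apply: n2; exists y => //; apply: lt_le_trans lty _.
  by rewrite lerD2l ge_min lexx orbT.
Qed.

Hypothesis r0 : 0 <= r.

Lemma sub_metric_cl A : A `<=` metric_cl A.
Proof.
move=> x Ax; apply/metric_clP => e e0; exists x => //.
by rewrite mdistxx ltr_wpDl.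
Qed.

Definition metric_cspace : closureSpace :=
  ClosureSpace metric_cl0 sub_metric_cl metric_clU.

End metric_closure_space.
Arguments metric_cspace {R} M {r} r0.

Section circle.
Context (R : realType).

Definition circle_rel (x y : R) : bool := x - y \is a Num.int.

Lemma circle_rel_equiv : equiv_class_of circle_rel.
Proof.
split=> [x|x y|y x z]; rewrite /circle_rel.
- by rewrite subrr rpred0.
- by rewrite -opprB rpredN.
- by move=> h1 h2; rewrite -(subrKA y) rpredD.
Qed.

Canonical circle_equiv := EquivRelPack circle_rel_equiv.

Definition circle := {eq_quot circle_equiv}.
HB.instance Definition _ := Choice.on circle.
HB.instance Definition _ := Quotient.on circle.

Lemma circle_eqP (x y : R) :
  \pi_circle x = \pi_circle y <-> exists k : int, x - y = k%:~R.
Proof.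
split=> [/eqmodP/intrP//|/intrP h]; exact/eqmodP.
Qed.

Definition dist_mod1 (x y : R) : R := inf [set `|x - y + k%:~R| | k in [set: int]].

Lemma dist_mod1_le x y (k : int) : dist_mod1 x y <= `|x - y + k%:~R|.
Proof.
apply: ge_inf; last by exists k.
by exists 0 => _ [j _ <-]; exact: normr_ge0.
Qed.

(* The infimum over the integers is a minimum. *)
Lemma dist_mod1_min x y : exists2 k : int, dist_mod1 x y = `|x - y + k%:~R| &
  forall j : int, `|x - y + k%:~R| <= `|x - y + j%:~R|.
Proof.
suff [k kmin] : exists k : int,
    forall j : int, `|x - y + k%:~R| <= `|x - y + j%:~R|.
  exists k => //; apply/eqP; rewrite eq_le dist_mod1_le /=.
  by apply: lb_le_inf; [exists `|x - y + k%:~R|; exists k|move=> _ [j _ <-]].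
set z := x - y; pose n := Num.floor z.
have zn : n%:~R <= z by exact: floor_le_tmp.
have zn1 : z < (n + 1)%:~R by exact: floorD1_gt.
have kP (j : int) : - n <= j -> `|z + (- n)%:~R| <= `|z + j%:~R|.
  move=> nj; have nj' : (- n)%:~R <= j%:~R :> R by rewrite ler_int.
  have zn0 : 0 <= z + (- n)%:~R by rewrite rmorphN /= subr_ge0.
  by rewrite !ger0_norm ?lerD2l// (le_trans zn0)// lerD2l.
have kN (j : int) : j < - n -> `|z + (- (n + 1))%:~R| <= `|z + j%:~R|.
  move=> nj; have nj' : j%:~R <= (- (n + 1))%:~R :> R.
    by rewrite ler_int opprD -ltzD1 subrK.
  have zn0 : z + (- (n + 1))%:~R <= 0 by rewrite rmorphN /= subr_le0 ltW.
  by rewrite !ler0_norm ?lerN2 ?lerD2l// (le_trans _ zn0)// lerD2l.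
have [le|/ltW le] := leP `|z + (- n)%:~R| `|z + (- (n + 1))%:~R|.
  by exists (- n) => j; have [/kP//|/kN] := leP (- n) j; exact: le_trans.
by exists (- (n + 1)) => j; have [/kP|/kN//] := leP (- n) j; exact: le_trans.
Qed.

Let dist_mod1_sub x y z : dist_mod1 x z <= dist_mod1 x y + dist_mod1 y z.
Proof.
have [k -> _] := dist_mod1_min x y; have [l -> _] := dist_mod1_min y z.
apply: le_trans (dist_mod1_le x z (k + l)) _.
rewrite (_ : x - z + (k + l)%:~R = (x - y + k%:~R) + (y - z + l%:~R)).
  exact: ler_normD.
by rewrite rmorphD /= [RHS]addrACA subrKA.
Qed.

Let dist_mod1C x y : dist_mod1 x y = dist_mod1 y x.
Proof.
wlog suff h : x y / dist_mod1 y x <= dist_mod1 x y.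
  by apply/eqP; rewrite eq_le !h.
have [k -> _] := dist_mod1_min x y.
apply: le_trans (dist_mod1_le y x (- k)) _.
by rewrite rmorphN /= -[y - x]opprB -opprD normrN.
Qed.

Let dist_mod1_eq0 x y : circle_rel x y <-> dist_mod1 x y = 0.
Proof.
split=> [/intrP[k xyk]|xy0].
  apply/eqP; rewrite eq_le; apply/andP; split.
    apply: le_trans (dist_mod1_le x y (- k)) _.
    by rewrite xyk rmorphN /= subrr normr0.
  by have [l -> _] := dist_mod1_min x y.
have [k] := dist_mod1_min x y; rewrite xy0 => /esym/normr0_eq0/eqP + _.
rewrite addr_eq0 => /eqP xyk; apply/intrP; exists (- k).
by rewrite xyk rmorphN.
Qed.

Definition circle_dist (a b : circle) : R := dist_mod1 (repr a) (repr b).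

Let circle_distxx a : circle_dist a a = 0.
Proof. by apply/dist_mod1_eq0; rewrite /circle_rel subrr rpred0. Qed.

Let circle_dist_eq0 a b : circle_dist a b = 0 -> a = b.
Proof.
by move=> /dist_mod1_eq0 ab; rewrite -[a]reprK -[b]reprK; exact/eqmodP.
Qed.

Let circle_distC a b : circle_dist a b = circle_dist b a.
Proof. exact: dist_mod1C. Qed.

Let circle_dist_triangle b a c :
  circle_dist a c <= circle_dist a b + circle_dist b c.
Proof. exact: dist_mod1_sub. Qed.

HB.instance Definition _ := @isMetric.Build R circle circle_dist
  circle_distxx circle_dist_eq0 circle_distC circle_dist_triangle.

Lemma circle_distE (x y : R) :
  mdist (\pi_circle x) (\pi_circle y) = dist_mod1 x y.
Proof.
rewrite [LHS]/(dist_mod1 _ _).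
case: piP => x' /eqmodP xx'; case: piP => y' /eqmodP yy'.
have /dist_mod1_eq0 x0 := xx'; have /dist_mod1_eq0 y0 := yy'.
apply/eqP; rewrite eq_le; apply/andP; split.
  apply: le_trans (dist_mod1_sub x' x y') _.
  rewrite dist_mod1C x0 add0r; apply: le_trans (dist_mod1_sub x y y') _.
  by rewrite y0 addr0.
apply: le_trans (dist_mod1_sub x x' y) _.
rewrite x0 add0r; apply: le_trans (dist_mod1_sub x' y' y) _.
by rewrite [dist_mod1 y' y]dist_mod1C y0 addr0.
Qed.

End circle.

Section unit_interval.
Context (R : realType).

Definition itv01 : set R := `[0, 1]%classic.

Definition unitI : closureSpace := topo_cspace itv01.

Let mem01 (x : R) : 0 <= x <= 1 -> x \in itv01.
Proof. by move=> x01; apply/mem_set; rewrite /itv01 /= in_itv. Qed.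

Definition mkI (x : R) (x01 : 0 <= x <= 1) : unitI :=
  exist (fun y => y \in itv01) x (mem01 x01).

Definition Ival (t : unitI) : R := set_val t.

Definition I0 : unitI := mkI (introT andP (conj (lexx 0) ler01)).
Definition I1 : unitI := mkI (introT andP (conj ler01 (lexx 1))).

Lemma I01 (t : unitI) : 0 <= Ival t <= 1.
Proof. by have := set_mem (valP t); rewrite /itv01 /= in_itv. Qed.

Let clamp01 (x : R) : 0 <= Num.max 0 (Num.min x 1) <= 1.
Proof. by rewrite le_max lexx ge_max ler01 ge_min lexx orbT. Qed.

(* A retraction of R onto the unit interval, through which real expressions
   with values in [0, 1] are read as points of unitI. *)
Definition clampI (x : R) : unitI := mkI (clamp01 x).

Lemma IvalK (x : R) : 0 <= x <= 1 -> Ival (clampI x) = x.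
Proof.
by case/andP=> x0 x1; rewrite /Ival set_valE /= (min_l x1) max_r.
Qed.

Lemma Ival_inj (s t : unitI) : Ival s = Ival t -> s = t.
Proof. by rewrite /Ival set_valE => /val_inj. Qed.

Lemma clampIK (t : unitI) : clampI (Ival t) = t.
Proof. by apply: Ival_inj; rewrite IvalK ?I01. Qed.

Lemma Ival0 : Ival I0 = 0. Proof. by rewrite /Ival set_valE. Qed.

Lemma Ival1 : Ival I1 = 1. Proof. by rewrite /Ival set_valE. Qed.

Lemma clampI0 : clampI 0 = I0. Proof. by rewrite -Ival0 clampIK. Qed.

Lemma clampI1 : clampI 1 = I1. Proof. by rewrite -Ival1 clampIK. Qed.

Lemma Ival_continuous : continuous (Ival : itv01 -> R).
Proof. exact: initial_continuous. Qed.

Lemma clampI_continuous : continuous (clampI : R -> itv01).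
Proof.
apply: continuous_comp_initial.
rewrite (_ : _ \o _ = (cst 0 \max (idfun \min cst 1))); last first.
  by apply/funext => x; rewrite /= set_valE.
move=> x; apply: continuous_max; first exact: cvg_cst.
by apply: continuous_min; [exact: cvg_id|exact: cvg_cst].
Qed.

End unit_interval.
Arguments itv01 R : clear implicits.
Arguments unitI {R}.
Arguments I0 {R}.
Arguments I1 {R}.

Section ccontinuous_theory.

Lemma ccontinuous_comp (X Y Z : closureSpace) (f : X -> Y) (g : Y -> Z) :
  ccontinuous f -> ccontinuous g -> ccontinuous (g \o f).
Proof.
by move=> /ccontinuousP fc /ccontinuousP gc; apply/ccontinuousP => x U /gc/fc.
Qed.

Lemma ccontinuous_cst (X Y : closureSpace) (y : Y) :
  @ccontinuous X Y (fun=> y).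
Proof.
by apply/ccontinuousP => x U /cnbhd_self Uy; apply: cnbhdS (cnbhdT x) => ? _.
Qed.

Lemma ccontinuous_paste (X Y : closureSpace) (L M : set X) (p q h : X -> Y) :
  ccontinuous p -> ccontinuous q ->
  (forall x, (cnbhd x L \/ cnbhd x M) \/ (p x = h x /\ q x = h x)) ->
  (forall x, L x -> h x = p x) -> (forall x, M x -> h x = q x) ->
  (forall x, h x = p x \/ h x = q x) -> ccontinuous h.
Proof.
move=> /ccontinuousP pc /ccontinuousP qc LM hp hq hpq.
apply/ccontinuousP => x U.
have [[nL|nM]|[<-]] := LM x.
- rewrite (hp _ (cnbhd_self nL)) => /pc/(cnbhdI nL); apply: cnbhdS => y [/hp].
  by rewrite /preimage /= => ->.
- rewrite (hq _ (cnbhd_self nM)) => /qc/(cnbhdI nM); apply: cnbhdS => y [/hq].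
  by rewrite /preimage /= => ->.
- move=> qp pU; have := pU; rewrite -[p x]qp => /qc/(cnbhdI (pc _ _ pU)).
  by apply: cnbhdS => y [pU' qU']; rewrite /preimage /=; case: (hpq y) => ->.
Qed.

Lemma topo_ccontinuous (S T : topologicalType) (f : S -> T) : continuous f ->
  @ccontinuous (topo_cspace S) (topo_cspace T) f.
Proof.
move=> fc; apply/ccontinuousP => x U /topo_cnbhdE Ux; apply/topo_cnbhdE.
exact: fc.
Qed.

Lemma prod_topo_cnbhdE (S T : topologicalType) (p : S * T) (U : set (S * T)) :
  @cnbhd (prod_cspace (topo_cspace S) (topo_cspace T)) p U <-> nbhs p U.
Proof.
split=> [/prod_cnbhdP[V [W [/topo_cnbhdE nV /topo_cnbhdE nW VWU]]]|].
  by exists (V, W).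
move=> [[V W] [/= nV nW] VWU]; apply/prod_cnbhdP; exists V, W.
by split=> //; exact/topo_cnbhdE.
Qed.

Lemma prod_topo_ccontinuous (S S' T : topologicalType) (f : S * S' -> T) :
  continuous f ->
  @ccontinuous (prod_cspace (topo_cspace S) (topo_cspace S')) (topo_cspace T) f.
Proof.
move=> fc; apply/ccontinuousP => x U /topo_cnbhdE Ux; apply/prod_topo_cnbhdE.
exact: fc.
Qed.

Lemma prod_topo2_ccontinuous (S S' T T' : topologicalType)
    (f : S * S' -> T * T') : continuous f ->
  @ccontinuous (prod_cspace (topo_cspace S) (topo_cspace S'))
    (prod_cspace (topo_cspace T) (topo_cspace T')) f.
Proof.
move=> fc; apply/ccontinuousP => x U /prod_topo_cnbhdE Ux.
by apply/prod_topo_cnbhdE; exact: fc.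
Qed.

End ccontinuous_theory.

Section fundamental_group.
Context (R : realType) (X : closureSpace) (x : X).
Local Notation unitI := (@unitI R).
Local Notation itv01 := (itv01 R).

Record loop := Loop {
  loop_fun :> unitI -> X;
  loop_ccontinuous : ccontinuous loop_fun;
  loop0 : loop_fun I0 = x;
  loop1 : loop_fun I1 = x
}.

Lemma loopP (f g : loop) : f =1 g -> f = g.
Proof.
case: f g => [f fc f0 f1] [g gc g0 g1] /= /funext fg; case: g / fg gc g0 g1.
by move=> gc g0 g1; congr Loop; exact: Prop_irrelevance.
Qed.

HB.instance Definition _ := gen_eqMixin loop.
HB.instance Definition _ := gen_choiceMixin loop.

(* Homotopy rel endpoints; the second coordinate is the deformation
   parameter. *)
Definition homotopic (f g : loop) : Prop :=
  exists H : prod_cspace unitI unitI -> X, [/\ ccontinuous H,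
    forall s, H (s, I0) = f s, forall s, H (s, I1) = g s,
    forall t, H (I0, t) = x & forall t, H (I1, t) = x].

Let half : R := 2^-1.
Let half2 : 2 * half = 1. Proof. by rewrite /half divff // pnatr_eq0. Qed.

Let ccontinuous_if (Y : closureSpace) (a : Y -> R) (p q : Y -> X) :
  (forall y, a y < half -> cnbhd y [set z | a z < half]) ->
  (forall y, half < a y -> cnbhd y [set z | half < a z]) ->
  ccontinuous p -> ccontinuous q -> (forall y, a y = half -> p y = q y) ->
  ccontinuous (fun y => if a y <= half then p y else q y).
Proof.
move=> aL aM pc qc pq.
apply: (@ccontinuous_paste _ _ [set z | a z < half] [set z | half < a z] p q)=> //.
- move=> y; have [/aL|/aM|ay] := ltgtP (a y) half; [by left; left|by left; right|].
  by right; rewrite pq.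
- by move=> y /= /ltW ->.
- by move=> y /=; rewrite leNgt => ->.
- by move=> y; case: ifP; [left|right].
Qed.

Let cont_dbl : continuous (fun t : itv01 => 2 * Ival t).
Proof. by move=> y; exact: (cvgM (cvg_cst _) (@Ival_continuous R y)). Qed.

Let cont_dbl1 : continuous (fun t : itv01 => 2 * Ival t - 1).
Proof. by move=> y; exact: (cvgB (@cont_dbl y) (cvg_cst _)). Qed.

Let cont_opp : continuous (fun t : itv01 => 1 - Ival t).
Proof. by move=> y; exact: (cvgB (cvg_cst _) (@Ival_continuous R y)). Qed.

Let cont_clamp (T : topologicalType) (a : T -> R) :
  continuous a -> continuous (fun t => clampI (a t) : itv01).
Proof.
by move=> ac y; apply: (continuous_comp (ac y)); exact: clampI_continuous.
Qed.

Let loop_clamp (f : loop) (a : itv01 -> R) : continuous a ->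
  @ccontinuous unitI X (fun t => f (clampI (a t))).
Proof.
move=> /cont_clamp/topo_ccontinuous ac.
exact: (@ccontinuous_comp unitI unitI X _ _ ac (@loop_ccontinuous f)).
Qed.

Let cont_pair (S T U : topologicalType) (f : S -> T) (g : S -> U) :
  continuous f -> continuous g -> continuous (fun s => (f s, g s)).
Proof. by move=> fc gc y; exact: (cvg_pair (fc y) (gc y)). Qed.

Let comp_fst (S T U : topologicalType) (f : S -> U) :
  continuous f -> continuous (fun p : S * T => f p.1).
Proof.
by move=> fc y; exact: (@continuous_comp _ _ _ fst f y cvg_fst (fc y.1)).
Qed.

Let comp_snd (S T U : topologicalType) (f : T -> U) :
  continuous f -> continuous (fun p : S * T => f p.2).
Proof.
by move=> fc y; exact: (@continuous_comp _ _ _ snd f y cvg_snd (fc y.2)).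
Qed.

Let cont_clampL (a : itv01 -> R) : continuous a ->
  continuous (fun p : itv01 * itv01 => (clampI (a p.1), p.2) : itv01 * itv01).
Proof.
move=> /cont_clamp ac; apply: cont_pair; first exact: (comp_fst ac).
by move=> y; exact: cvg_snd.
Qed.

Let cont_clampR (a : itv01 -> R) : continuous a ->
  continuous (fun p : itv01 * itv01 => (p.1, clampI (a p.2)) : itv01 * itv01).
Proof.
move=> /cont_clamp ac; apply: cont_pair; last exact: (comp_snd ac).
by move=> y; exact: cvg_fst.
Qed.

Let cont_fst : continuous (fun p : itv01 * itv01 => @Ival R p.1).
Proof. exact: comp_fst (@Ival_continuous R). Qed.

Let cont_snd : continuous (fun p : itv01 * itv01 => @Ival R p.2).
Proof. exact: comp_snd (@Ival_continuous R). Qed.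

Let nbhs_lt (T : topologicalType) (a : T -> R) (y : T) : continuous a ->
  a y < half -> nbhs y [set z | a z < half].
Proof.
by move=> ac ay; apply: (ac y [set z | z < half]); apply: open_nbhs_nbhs; split=> //; exact: open_lt.
Qed.

Let nbhs_gt (T : topologicalType) (a : T -> R) (y : T) : continuous a ->
  half < a y -> nbhs y [set z | half < a z].
Proof.
by move=> ac ay; apply: (ac y [set z | half < z]); apply: open_nbhs_nbhs; split=> //; exact: open_gt.
Qed.

Definition concat_fun (f g : unitI -> X) (t : unitI) : X :=
  if Ival t <= 2^-1 then f (clampI (2 * Ival t))
  else g (clampI (2 * Ival t - 1)).

Lemma concat_funL (f g : unitI -> X) (t : unitI) :
  Ival t <= 2^-1 -> concat_fun f g t = f (clampI (2 * Ival t)).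
Proof. by rewrite /concat_fun => ->. Qed.

Lemma concat_funR (f g : unitI -> X) (t : unitI) : f I1 = g I0 ->
  2^-1 <= Ival t -> concat_fun f g t = g (clampI (2 * Ival t - 1)).
Proof.
move=> fg; rewrite /concat_fun -/half le_eqVlt => /predU1P[<-|].
  by rewrite lexx half2 subrr clampI1 clampI0.
by rewrite ltNge => /negbTE ->.
Qed.

Section concat.
Variables f g : loop.

Lemma concat_ccontinuous : ccontinuous (concat_fun f g).
Proof.
apply: (@ccontinuous_if unitI (@Ival R) (fun t => f (clampI (2 * Ival t)))
  (fun t => g (clampI (2 * Ival t - 1)))).
- by move=> y ay; apply/topo_cnbhdE; apply: (nbhs_lt (@Ival_continuous R)).
- by move=> y ay; apply/topo_cnbhdE; apply: (nbhs_gt (@Ival_continuous R)).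
- exact: loop_clamp cont_dbl.
- exact: loop_clamp cont_dbl1.
- by move=> y ->; rewrite half2 subrr clampI0 clampI1 loop0 loop1.
Qed.

Lemma concat0 : concat_fun f g I0 = x.
Proof. by rewrite concat_funL Ival0 ?invr_ge0// mulr0 clampI0 loop0. Qed.

Lemma concat1 : concat_fun f g I1 = x.
Proof.
rewrite concat_funR ?Ival1 ?invf_le1 ?ler1n ?loop0 ?loop1// mulr1.
by rewrite (_ : 2 - 1 = 1) ?clampI1 ?loop1// addrK.
Qed.

Definition concat : loop := Loop concat_ccontinuous concat0 concat1.

End concat.

Definition const_loop : loop :=
  Loop (@ccontinuous_cst unitI X x) erefl erefl.

Definition rev_fun (f : unitI -> X) (t : unitI) : X := f (clampI (1 - Ival t)).

Section rev.
Variable f : loop.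

Lemma rev_ccontinuous : ccontinuous (rev_fun f).
Proof. exact: loop_clamp cont_opp. Qed.

Lemma rev0 : rev_fun f I0 = x.
Proof. by rewrite /rev_fun Ival0 subr0 clampI1 loop1. Qed.

Lemma rev1 : rev_fun f I1 = x.
Proof. by rewrite /rev_fun Ival1 subrr clampI0 loop0. Qed.

Definition rev_loop : loop := Loop rev_ccontinuous rev0 rev1.

End rev.

Lemma rev_loopK (f : loop) : rev_loop (rev_loop f) = f.
Proof.
apply: loopP => t; have /andP[t0 t1] := I01 t; rewrite /= /rev_fun IvalK.
  by rewrite subKr clampIK.
by rewrite subr_ge0 t1 lerBlDr lerDl.
Qed.

Lemma homotopic_reparam (f u v : loop) (a b : itv01 -> R) :
  continuous a -> continuous b ->
  (forall t, u t = f (clampI (a t))) -> (forall t, v t = f (clampI (b t))) ->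
  a I0 = b I0 -> a I1 = b I1 -> homotopic u v.
Proof.
move=> ac bc ua vb ab0 ab1.
pose h (p : itv01 * itv01) : itv01 :=
  clampI ((1 - Ival p.2) * a p.1 + Ival p.2 * b p.1).
exists (f \o h); split=> [|s|s|t|t] /=.
- apply: ccontinuous_comp; last exact: loop_ccontinuous.
  apply: prod_topo_ccontinuous; apply: cont_clamp => y.
  have ac' := @comp_fst _ itv01 _ _ ac y.
  have bc' := @comp_fst _ itv01 _ _ bc y.
  exact: (cvgD (cvgM (cvgB (cvg_cst _) (@cont_snd y)) ac')
    (cvgM (@cont_snd y) bc')).
- by rewrite /h /= Ival0 subr0 mul1r mul0r addr0 ua.
- by rewrite /h /= Ival1 subrr mul1r mul0r add0r vb.
- by rewrite /h /= -ab0 -mulrDl subrK mul1r -ua loop0.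
- by rewrite /h /= -ab1 -mulrDl subrK mul1r -ua loop1.
Qed.

Lemma homotopic_refl f : homotopic f f.
Proof.
apply: (@homotopic_reparam f f f (@Ival R) (@Ival R)) => //;
  try exact: Ival_continuous; by move=> t; rewrite clampIK.
Qed.

Let ccont_prod (h : itv01 * itv01 -> itv01 * itv01)
    (H : prod_cspace unitI unitI -> X) :
  ccontinuous H -> continuous h ->
  @ccontinuous (prod_cspace unitI unitI) X (H \o h).
Proof.
by move=> Hc hc; apply: ccontinuous_comp Hc; exact: prod_topo2_ccontinuous.
Qed.

Lemma homotopic_sym f g : homotopic f g -> homotopic g f.
Proof.
move=> [H [Hc Hf Hg H0 H1]].
pose h (p : itv01 * itv01) : itv01 * itv01 := (p.1, clampI (1 - Ival p.2)).
exists (H \o h); split=> [|s|s|t|t]; rewrite /h /= ?H0 ?H1//.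
- apply: ccont_prod => //; exact: cont_clampR cont_opp.
- by rewrite Ival0 subr0 clampI1.
- by rewrite Ival1 subrr clampI0.
Qed.

Lemma homotopic_trans g f k : homotopic f g -> homotopic g k -> homotopic f k.
Proof.
move=> [H [Hc Hf Hg H0 H1]] [K [Kc Kg Kk K0 K1]].
pose hL (p : itv01 * itv01) : itv01 * itv01 := (p.1, clampI (2 * Ival p.2)).
pose hR (p : itv01 * itv01) : itv01 * itv01 := (p.1, clampI (2 * Ival p.2 - 1)).
exists (fun p => if Ival p.2 <= half then H (hL p) else K (hR p)).
split=> [|s|s|t|t] /=.
- apply: ccontinuous_if.
  + move=> y ay; apply/prod_topo_cnbhdE.
    exact: (nbhs_lt cont_snd).
  + move=> y ay; apply/prod_topo_cnbhdE.
    exact: (nbhs_gt cont_snd).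
  + apply: ccont_prod => //; exact: cont_clampR cont_dbl.
  + apply: ccont_prod => //; exact: cont_clampR cont_dbl1.
  + by move=> y yh; rewrite /hL /hR yh half2 subrr clampI0 clampI1 Hg Kg.
- by rewrite Ival0 invr_ge0 ler0n /hL /= Ival0 mulr0 clampI0.
- rewrite Ival1 leNgt invf_lt1 ?ltr1n//= /hR /= Ival1 mulr1.
  by rewrite addrK clampI1.
- by case: ifP; rewrite /hL /hR /= ?H0 ?K0.
- by case: ifP; rewrite /hL /hR /= ?H1 ?K1.
Qed.

Lemma homotopic_concat f f' g g' : homotopic f f' -> homotopic g g' ->
  homotopic (concat f g) (concat f' g').
Proof.
move=> [H [Hc Hf Hf' H0 H1]] [K [Kc Kg Kg' K0 K1]].
pose hL (p : itv01 * itv01) : itv01 * itv01 := (clampI (2 * Ival p.1), p.2).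
pose hR (p : itv01 * itv01) : itv01 * itv01 := (clampI (2 * Ival p.1 - 1), p.2).
exists (fun p => if Ival p.1 <= half then H (hL p) else K (hR p)).
split=> [|s|s|t|t] /=.
- apply: ccontinuous_if.
  + move=> y ay; apply/prod_topo_cnbhdE.
    exact: (nbhs_lt cont_fst).
  + move=> y ay; apply/prod_topo_cnbhdE.
    exact: (nbhs_gt cont_fst).
  + apply: ccont_prod => //; exact: cont_clampL cont_dbl.
  + apply: ccont_prod => //; exact: cont_clampL cont_dbl1.
  + by move=> y yh; rewrite /hL /hR yh half2 subrr clampI0 clampI1 H1 K0.
- by rewrite /hL /hR /= Hf Kg.
- by rewrite /hL /hR /= Hf' Kg'.
- by rewrite Ival0 invr_ge0 ler0n /hL /= Ival0 mulr0 clampI0.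
- rewrite Ival1 leNgt invf_lt1 ?ltr1n//= /hR /= Ival1 mulr1.
  by rewrite addrK clampI1.
Qed.

Lemma homotopic_rev f g : homotopic f g -> homotopic (rev_loop f) (rev_loop g).
Proof.
move=> [H [Hc Hf Hg H0 H1]].
pose h (p : itv01 * itv01) : itv01 * itv01 := (clampI (1 - Ival p.1), p.2).
exists (H \o h); split=> [|s|s|t|t]; rewrite /h /=.
- apply: ccont_prod => //; exact: cont_clampL cont_opp.
- by rewrite Hf.
- by rewrite Hg.
- by rewrite Ival0 subr0 clampI1.
- by rewrite Ival1 subrr clampI0.
Qed.

Let cont_affine (a b : R) : continuous (fun t : itv01 => a * Ival t + b).
Proof.
move=> y.
exact: (cvgD (cvgM (cvg_cst _) (@Ival_continuous R y)) (cvg_cst _)).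
Qed.

Let cont_min (a b : itv01 -> R) : continuous a -> continuous b ->
  continuous (fun t => Num.min (a t) (b t)).
Proof. by move=> ac bc y; exact: (continuous_min (ac y) (bc y)). Qed.

Let cont_max (a b : itv01 -> R) : continuous a -> continuous b ->
  continuous (fun t => Num.max (a t) (b t)).
Proof. by move=> ac bc y; exact: (continuous_max (ac y) (bc y)). Qed.

Let cont_cst (a : R) : continuous (fun _ : itv01 => a).
Proof. exact: cst_continuous. Qed.

Lemma concat_const f : homotopic (concat f const_loop) f.
Proof.
apply: (@homotopic_reparam f _ _ (fun t => Num.min (2 * Ival t + 0) 1) (@Ival R)).
- exact: (cont_min (@cont_affine _ _) (@cont_cst _)).
- exact: Ival_continuous.
- move=> t; rewrite addr0; have [th|th] := leP (Ival t) 2^-1.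
    rewrite /= concat_funL// min_l//; lra.
  rewrite /= concat_funR ?loop1 ?ltW// min_r ?clampI1 ?loop1//; lra.
- by move=> t; rewrite clampIK.
- by rewrite Ival0 mulr0 addr0 min_l.
- by rewrite Ival1 mulr1 addr0 min_r// ler1n.
Qed.

Lemma const_concat f : homotopic (concat const_loop f) f.
Proof.
apply: (@homotopic_reparam f _ _ (fun t => Num.max (2 * Ival t - 1) 0) (@Ival R)).
- exact: (cont_max (@cont_affine _ _) (@cont_cst _)).
- exact: Ival_continuous.
- move=> t; have [th|th] := leP (Ival t) 2^-1.
    rewrite /= concat_funL// max_r ?clampI0 ?loop0//; lra.
  rewrite /= concat_funR ?loop0 ?ltW// max_l//; lra.
- by move=> t; rewrite clampIK.
- by rewrite Ival0 mulr0 add0r max_r// oppr_le0.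
- by rewrite Ival1 mulr1 addrK max_l.
Qed.

Lemma concat_rev f : homotopic (concat f (rev_loop f)) const_loop.
Proof.
apply: (@homotopic_reparam f _ _
  (fun t => Num.min (2 * Ival t + 0) (- 2 * Ival t + 2)) (fun=> 0)).
- exact: (cont_min (@cont_affine _ _) (@cont_affine _ _)).
- exact: cont_cst.
- move=> t; have /andP[t0 t1] := I01 t; have [th|th] := leP (Ival t) 2^-1.
    rewrite /= concat_funL// min_l ?addr0//; lra.
  rewrite /= concat_funR ?loop0 ?loop1 ?ltW// ?rev0//.
  rewrite /rev_fun min_r; last lra.
  rewrite IvalK; last by apply/andP; split; lra.
  by congr (f (clampI _)); lra.
- by move=> t; rewrite clampI0 loop0.
- by rewrite Ival0 mulr0 addr0 mulr0 add0r min_l.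
- by rewrite Ival1 !mulr1 addNr min_r ?addr0.
Qed.

Lemma concatA f g h :
  homotopic (concat (concat f g) h) (concat f (concat g h)).
Proof.
pose a (t : itv01) : R := Num.min (2 * Ival t + 0)
  (Num.min (1 * Ival t + 2^-1 * 2^-1) (2^-1 * Ival t + 2^-1)).
apply: (@homotopic_reparam (concat f (concat g h)) _ _ a (@Ival R)).
- exact: (cont_min (@cont_affine _ _)
    (cont_min (@cont_affine _ _) (@cont_affine _ _))).
- exact: Ival_continuous.
- move=> t; have /andP[t0 t1] := I01 t; rewrite /a.
  have [th|/ltW th] := leP (Ival t) 2^-1.
    have t01 : 0 <= 2 * Ival t <= 1 by apply/andP; split; lra.
    rewrite /= concat_funL//.
    have [t4|/ltW t4] := leP (Ival t) (2^-1 * 2^-1).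
      rewrite min_l; last by rewrite le_min; apply/andP; split; lra.
      rewrite concat_funL IvalK//; last by lra.
      by rewrite addr0 concat_funL IvalK//; lra.
    rewrite [Num.min (1 * _ + _) _]min_l; last lra.
    rewrite min_r; last lra.
    rewrite concat_funR ?loop0 ?loop1 ?IvalK//; last lra.
    have u01 : 0 <= 1 * Ival t + 2^-1 * 2^-1 <= 1 by apply/andP; split; lra.
    rewrite concat_funR ?loop1 ?concat0 ?IvalK//; last lra.
    have v01 : 0 <= 2 * (1 * Ival t + 2^-1 * 2^-1) - 1 <= 1.
      by apply/andP; split; lra.
    by rewrite /= concat_funL ?IvalK//; [congr (g (clampI _)); lra|lra].
  rewrite [Num.min (1 * _ + _) _]min_r; last lra.
  rewrite min_r; last lra.
  rewrite /= concat_funR ?concat1 ?loop0//.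
  have u01 : 0 <= 2^-1 * Ival t + 2^-1 <= 1 by apply/andP; split; lra.
  rewrite concat_funR ?loop1 ?concat0 ?IvalK//; last lra.
  have v01 : 0 <= 2 * (2^-1 * Ival t + 2^-1) - 1 <= 1.
    by apply/andP; split; lra.
  by rewrite /= concat_funR ?loop0 ?loop1 ?IvalK//; [congr (h (clampI _)); lra|lra].
- by move=> t; rewrite clampIK.
- rewrite /a Ival0 min_l; first by lra.
  by rewrite le_min; apply/andP; split; lra.
- rewrite /a Ival1 [Num.min (1 * _ + _) _]min_r; last lra.
  by rewrite min_r; lra.
Qed.

Definition homotopicb (f g : loop) : bool := `[< homotopic f g >].

Lemma homotopicb_equiv : equiv_class_of homotopicb.
Proof.
split=> [f|f g|g f h]; first exact/asboolP/homotopic_refl.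
- by apply/asboolP/asboolP => /homotopic_sym.
- by move=> /asboolP fg /asboolP gh; apply/asboolP; exact: homotopic_trans gh.
Qed.

Canonical homotopic_equiv := EquivRelPack homotopicb_equiv.

Definition pi1 := {eq_quot homotopic_equiv}.
HB.instance Definition _ := Choice.on pi1.
HB.instance Definition _ := Quotient.on pi1.

Lemma pi1_eqP (f g : loop) : \pi_pi1 f = \pi_pi1 g <-> homotopic f g.
Proof. by split=> [/eqmodP/asboolP|/asboolP h]//; exact/eqmodP. Qed.

Definition pi1_one : pi1 := \pi_pi1 const_loop.
Definition pi1_mul (a b : pi1) : pi1 := \pi_pi1 (concat (repr a) (repr b)).
Definition pi1_inv (a : pi1) : pi1 := \pi_pi1 (rev_loop (repr a)).

Lemma pi1_mul_pi f g : pi1_mul (\pi_pi1 f) (\pi_pi1 g) = \pi_pi1 (concat f g).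
Proof.
by apply/pi1_eqP; apply: homotopic_concat; apply/pi1_eqP; rewrite reprK.
Qed.

Lemma pi1_inv_pi f : pi1_inv (\pi_pi1 f) = \pi_pi1 (rev_loop f).
Proof. by apply/pi1_eqP; apply: homotopic_rev; apply/pi1_eqP; rewrite reprK. Qed.

Let pi1_mulA : associative pi1_mul.
Proof.
elim/quotW => f; elim/quotW => g; elim/quotW => h.
rewrite (pi1_mul_pi g h) (pi1_mul_pi f) (pi1_mul_pi f g) (pi1_mul_pi _ h).
by apply/pi1_eqP; apply: homotopic_sym; exact: concatA.
Qed.

Let pi1_mul1g : left_id pi1_one pi1_mul.
Proof. by elim/quotW => f; rewrite pi1_mul_pi; apply/pi1_eqP/const_concat. Qed.

Let pi1_mulg1 : right_id pi1_one pi1_mul.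
Proof. by elim/quotW => f; rewrite pi1_mul_pi; apply/pi1_eqP/concat_const. Qed.

Let pi1_mulgV : right_inverse pi1_one pi1_inv pi1_mul.
Proof.
by elim/quotW => f; rewrite pi1_inv_pi pi1_mul_pi; apply/pi1_eqP/concat_rev.
Qed.

Let pi1_mulVg : left_inverse pi1_one pi1_inv pi1_mul.
Proof.
elim/quotW => f; rewrite pi1_inv_pi pi1_mul_pi; apply/pi1_eqP.
by rewrite -[X in concat _ X]rev_loopK; exact: concat_rev.
Qed.

HB.instance Definition _ := isGroup.Build pi1
  pi1_mulA pi1_mul1g pi1_mulg1 pi1_mulVg pi1_mulgV.

End fundamental_group.
Arguments pi1 R {X} x.

(* Main.v *)
Require Import Defs.
From mathcomp Require Import all_boot all_order all_algebra generic_quotient.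
From mathcomp Require Import all_classical all_reals topology normedtype.
From mathcomp Require Import lra.

(** For small [r] the line still covers the circle in the coarse sense given by
[c_r], and the isomorphism is the winding number: the total increment of a lift
of a loop to the line.

A map into [(S^1, c_r)] is continuous when, near each point [p], its values stay
within [r + e] of the value at [p], for every [e > 0]. Fix [rho] strictly between
[r] and 1/3, so that near [p] they stay within [rho]. Choose a lift [a] of the
value at [p] and lift each nearby value to within [rho] of [a]. If two values
near [p] are within [rho] of each other, then their lifts differ by less than
[2 rho], and also by an integer plus a number less than [rho] in absolute value;
since [3 rho <= 1], that integer is 0 and the lifts are within [rho] of each
other. So every map has local lifts whose jumps stay below [rho]
([lift_on_local]). This is the step that needs 1/3; the others only need
[2 rho <= 1].

Two lifts on a connected set differ by a constant ([lift_on_unique]), so lifts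
on closed sets with connected intersection can be glued ([lift_on_glue]), and
Cousin's lemma applied in each of the two directions yields a lift on the whole
square ([lift_on_square]). Lifts of loops give the existence of the winding
number, uniqueness of lifts makes it well defined and additive, and lifts of
homotopies make it a homotopy invariant. Affine paths realize every integer
([winds_surj]). Two loops with the same winding number have lifts with the same
endpoints, and the straight-line homotopy between these lifts projects to a
homotopy continuous for [c_r], because a convex combination of two displacements
less than [r + e] is less than [r + e] ([winds_inj]). *)

Set Implicit Arguments.
Unset Strict Implicit.
Unset Printing Implicit Defensive.

Import Order.TTheory GRing.Theory Num.Theory.
Import numFieldNormedType.Exports.

Local Open Scope classical_set_scope.
Local Open Scope ring_scope.
Local Open Scope quotient_scope.

(** * Connectedness and Cousin's lemma *)

Lemma connected_locally_constant (T : topologicalType) (V : Type) (D : set T)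
    (k : T -> V) : connected D ->
  (forall p, D p -> \forall q \near p, D q -> k q = k p) ->
  forall p q, D p -> D q -> k p = k q.
Proof.
move=> cD kD p q Dp Dq.
suff DE : D `&` [set z | k z = k p] = D by move: Dq; rewrite -DE => -[_ ->].
apply: cD; first by exists p.
- exists (interior [set z | D z -> k z = k p]); first exact: open_interior.
  apply/seteqP; split=> z [Dz]; last by move=> /nbhs_singleton/(_ Dz).
  by move=> <-; split=> //; exact: kD.
- exists (~` interior [set z | D z -> k z <> k p]).
    by apply: open_closedC; exact: open_interior.
  apply/seteqP; split=> z [Dz].
    by move=> kz; split=> // /nbhs_singleton/(_ Dz); exact.
  move=> nz; split=> //; apply: contrapT => kz; apply: nz.
  by apply: filterS (kD z Dz) => y + Dy => /(_ Dy) ->.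
Qed.

(** The supremum [s] of the points reachable from [a] is itself reachable, and
if it were less than [b] then the intervals around [s] on which [Q] holds would
lead further. Used in place of subdivisions finer than a Lebesgue number. *)
Lemma cousin (R : realType) (Q : R -> R -> Prop) (a b : R) : a <= b ->
  (forall u v w, u <= v -> v <= w -> Q u v -> Q v w -> Q u w) ->
  (forall s, a <= s <= b -> exists2 d, 0 < d &
    forall u v, s - d < u -> u <= s -> s <= v -> v < s + d -> Q u v) ->
  Q a b.
Proof.
move=> ab Qcat Qloc.
pose S := [set x | a <= x <= b /\ Q a x].
have Sa : S a.
  have [|d d0 Qd] := Qloc a; first by rewrite lexx.
  by split; [rewrite lexx|apply: Qd; rewrite ?lexx ?ltrBlDr ?ltrDl].
have Sub : has_ubound S by exists b => x [/andP[]].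
have Ssup : has_sup S by split=> //; exists a.
pose s := sup S.
have as_ : a <= s by apply: ub_le_sup.
have sb : s <= b by apply: ge_sup; [exists a|move=> x [/andP[]]].
have [|d d0 Qd] := Qloc s; first by rewrite as_.
have [x [/andP[ax xb] Qx] sx] := sup_adherent d0 Ssup.
have xs : x <= s by apply: ub_le_sup => //; split=> //; rewrite ax.
have Qs v : s <= v -> v < s + d -> Q a v.
  by move=> sv vd; apply: (Qcat _ x) => //; [exact: le_trans sv|exact: Qd].
have [bd|bd] := ltP b (s + d); first exact: Qs.
have : s + d / 2 <= s.
  apply: ub_le_sup => //; split; first by apply/andP; split; lra.
  by apply: Qs; lra.
by move=> ?; exfalso; lra.
Qed.

(** * The projection from the line to the circle *)

Section circle_projection.
Context (R : realType).
Implicit Types (a b : R) (y : circle R).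
Local Notation proj := (\pi_(circle R)).

Lemma proj_addz a (k : int) : proj (a + k%:~R) = proj a.
Proof. by apply/circle_eqP; exists k; rewrite addrAC subrr add0r. Qed.

Lemma mdist_proj_le a b : mdist (proj a) (proj b) <= `|a - b|.
Proof. by rewrite circle_distE -[a - b]addr0; exact: (dist_mod1_le a b 0). Qed.

Lemma proj_near a y : exists2 b, proj b = y & `|b - a| = mdist (proj a) y.
Proof.
rewrite -[y]reprK circle_distE.
have [k -> _] := dist_mod1_min a (repr y).
exists (repr y + (- k)%:~R); first exact: proj_addz.
by rewrite distrC rmorphN /= opprD opprK addrA.
Qed.

Lemma proj_inj_near a b : proj a = proj b -> `|a - b| < 1 -> a = b.
Proof.
move=> /circle_eqP[k abk]; rewrite abk -intr_norm -[1]/(1%:~R) ltr_int.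
case: k abk => [[|n]|n] //= abk _; apply/eqP; rewrite -subr_eq0 abk //.
Qed.

End circle_projection.

(** * Lifting coarsely continuous maps from the circle to the line *)

Lemma continuous_pair (S T U : topologicalType) (f : S -> T) (g : S -> U) :
  continuous f -> continuous g -> continuous (fun s => (f s, g s)).
Proof. by move=> fc gc s; exact: (cvg_pair (fc s) (gc s)). Qed.

Lemma continuous_pairl (S T : topologicalType) (t : T) :
  continuous (fun s : S => (s, t)).
Proof. by apply: continuous_pair => s; [exact: cvg_id|exact: cvg_cst]. Qed.

Lemma continuous_pairr (S T : topologicalType) (s : S) :
  continuous (fun t : T => (s, t)).
Proof. by apply: continuous_pair => t; [exact: cvg_cst|exact: cvg_id]. Qed.

Section lifting.
Context (R : realType) (rho : R).
Hypothesis rho_small : rho <= 3^-1.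
Local Notation proj := (\pi_(circle R)).

Let rho3 : rho + rho + rho <= 1.
Proof. by have := rho_small; lra. Qed.

(** What lifting needs from continuity for [c_r] when [r < rho]. The condition
is not uniform: the values at two points near [p] are only known to be within
[2 rho] of each other. *)
Definition coarse (T : topologicalType) (F : T -> circle R) :=
  forall p, \forall q \near p, mdist (F p) (F q) < rho.

(** A lift as for covering spaces, with a bound on the jumps in place of
continuity. *)
Definition lift_on (T : topologicalType) (D : set T) (F : T -> circle R)
    (g : T -> R) :=
  (forall p, D p -> proj (g p) = F p) /\
  forall p, D p -> \forall q \near p, D q -> `|g q - g p| < rho.

Section lift_on_theory.
Context (T : topologicalType) (F : T -> circle R).
Implicit Types (D E : set T) (g : T -> R).

Lemma lift_onS D E g : E `<=` D -> lift_on D F g -> lift_on E F g.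
Proof.
move=> ED [gF gc]; split=> p Ep; first by apply: gF; exact: ED.
by apply: filterS (gc p (ED _ Ep)) => q + Eq; apply; exact: ED.
Qed.

Lemma lift_on_addz D g (k : int) :
  lift_on D F g -> lift_on D F (fun p => g p + k%:~R).
Proof.
move=> [gF gc]; split=> p Dp; first by rewrite proj_addz gF.
by apply: filterS (gc p Dp) => q; rewrite (addrC (g p)) addrKA.
Qed.

Lemma lift_on_comp (U : topologicalType) (phi : U -> T) D (E : set U) g :
  continuous phi -> (forall u, E u -> D (phi u)) ->
  lift_on D F g -> lift_on E (F \o phi) (g \o phi).
Proof.
move=> phic ED [gF gc]; split=> u Eu; first by rewrite /= gF //; exact: ED.
have := phic u _ (gc _ (ED _ Eu)); rewrite /nbhs /=.
by apply: filterS => v /= h /ED.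
Qed.

(** Each value near [p] is lifted to within [rho] of a fixed lift [a] of the
value at [p]. Two such lifts [g q] and [g z] differ by less than [2 rho], and
[g z] agrees modulo 1 with a point within [rho] of [g q]; the integer by which
they differ is then less than [3 rho <= 1] in absolute value, so it vanishes.
*)
Lemma lift_on_local p : coarse F -> exists g,
  lift_on [set q | mdist (F p) (F q) < rho] F g.
Proof.
move=> Fc; pose a := repr (F p).
have /choice[g gP] q : exists b : R,
    proj b = F q /\ `|b - a| = mdist (F p) (F q).
  by have [b bq ba] := proj_near a (F q); exists b; rewrite ba reprK.
exists g; split=> [q _|q /= Vq]; first by have [] := gP q.
apply: filterS (Fc q) => z qz Vz.
have [gq aq] := gP q; have [gz az] := gP z.
have [b bz bq] := proj_near (g q) (F z).
suff -> : g z = b by rewrite bq gq.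
apply: proj_inj_near; first by rewrite gz bz.
rewrite gq in bq.
apply: (@lt_le_trans _ _ (rho + rho + rho)) => //.
rewrite (_ : g z - b = (g z - a) - (g q - a) - (b - g q)); last by lra.
apply: le_lt_trans (ler_normB _ _) _; rewrite ltrD ?bq //.
by apply: le_lt_trans (ler_normB _ _) _; rewrite ltrD ?aq ?az.
Qed.

(** The difference of two lifts takes integer values and changes by less than
[2 rho <= 1] near each point, so it is locally constant. *)
Lemma lift_on_unique D g1 g2 : connected D ->
  lift_on D F g1 -> lift_on D F g2 ->
  forall p q, D p -> D q -> g1 p - g2 p = g1 q - g2 q.
Proof.
move=> cD [g1F g1c] [g2F g2c].
apply: (connected_locally_constant (k := fun z => g1 z - g2 z) cD) => p Dp.
near=> q => Dq.
have q1 : `|g1 q - g1 p| < rho by apply: (near (g1c p Dp) q).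
have q2 : `|g2 q - g2 p| < rho by apply: (near (g2c p Dp) q).
have /circle_eqP[k pk] : proj (g1 p) = proj (g2 p) by rewrite g1F ?g2F.
rewrite pk; apply/eqP; rewrite subr_eq addrC; apply/eqP.
apply: proj_inj_near; first by rewrite proj_addz g1F ?g2F.
apply: (@lt_le_trans _ _ (rho + rho)); last by have := rho_small; lra.
rewrite -pk (_ : _ - _ = (g1 q - g1 p) - (g2 q - g2 p)); last by lra.
by apply: le_lt_trans (ler_normB _ _) _; rewrite ltrD.
Unshelve. all: by end_near. Qed.

(** By uniqueness the two lifts differ by an integer on the intersection, and
after a shift they agree there. Near a point of both sets the jumps of the glued
lift are bounded from the side on which the second point lies; near a point of
one set only, there are no points of the other because it is closed. *)
Lemma lift_on_glue D1 D2 : closed D1 -> closed D2 -> connected (D1 `&` D2) ->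
  (exists g, lift_on D1 F g) -> (exists g, lift_on D2 F g) ->
  exists g, lift_on (D1 `|` D2) F g.
Proof.
move=> cl1 cl2 con [g1 l1] [g2' l2'].
have [g2 [l2 g12]] : exists g2, lift_on D2 F g2 /\
    forall p, D1 p -> D2 p -> g2 p = g1 p.
  have [[p [D1p D2p]]|n12] := pselect (D1 `&` D2 !=set0); last first.
    by exists g2'; split=> // p ? ?; exfalso; apply: n12; exists p.
  have /circle_eqP[k pk] : proj (g1 p) = proj (g2' p).
    by rewrite (proj1 l1) ?(proj1 l2').
  exists (fun q => g2' q + k%:~R); split; first exact: lift_on_addz.
  move=> q D1q D2q; rewrite -pk.
  rewrite (lift_on_unique con (lift_onS _ l1) (lift_onS _ l2') (q := q)) //.
  by rewrite addrC subrK.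
have [[g1F g1c] [g2F g2c]] := (l1, l2).
pose g q := if q \in D1 then g1 q else g2 q.
have gD1 q : D1 q -> g q = g1 q by move=> /mem_set; rewrite /g => ->.
have gD2 q : D2 q -> g q = g2 q.
  by rewrite /g => D2q; case: ifP => // /set_mem D1q; rewrite g12.
have off D p : closed D -> ~ D p -> \forall q \near p, ~ D q.
  by move=> cD Dp; apply: open_nbhs_nbhs; split=> //; exact: closed_openC.
have n1 p : \forall q \near p, D1 q -> D1 p /\ `|g1 q - g1 p| < rho.
  have [Dp|/(off _ _ cl1)] := pselect (D1 p); last by apply: filterS => q.
  by apply: filterS (g1c p Dp) => q + Dq => /(_ Dq).
have n2 p : \forall q \near p, D2 q -> D2 p /\ `|g2 q - g2 p| < rho.
  have [Dp|/(off _ _ cl2)] := pselect (D2 p); last by apply: filterS => q.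
  by apply: filterS (g2c p Dp) => q + Dq => /(_ Dq).
exists g; split=> p Dp.
  by case: Dp => Dp; [rewrite gD1 ?g1F|rewrite gD2 ?g2F].
apply: filterS2 (n1 p) (n2 p) => q q1 q2 [/[dup] Dq /q1|/[dup] Dq /q2] [Dp' ?].
  by rewrite !gD1.
by rewrite !gD2.
Qed.

End lift_on_theory.

Definition rect (a b c d : R) : set (R * R) :=
  [set p | (a <= p.1 <= b) && (c <= p.2 <= d)].

Lemma rectE a b c d : rect a b c d = `[a, b] `*` `[c, d].
Proof.
apply/seteqP; split=> p; rewrite /rect /= !in_itv /=; first by move=> /andP.
by move=> [-> ->].
Qed.

Lemma closed_rect a b c d : closed (rect a b c d).
Proof.
rewrite rectE (_ : _ `*` _ = fst @^-1` `[a, b] `&` snd @^-1` `[c, d]) //.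
apply: closedI; apply: preimage_closed.
all: try exact: interval_closed.
- by move=> p _; exact: cvg_fst.
- by move=> p _; exact: cvg_snd.
Qed.

Lemma connected_hsegment a b c : connected (rect a b c c).
Proof.
suff -> : rect a b c c = (fun x => (x, c)) @` `[a, b].
  apply: connected_continuous_connected; first exact: segment_connected.
  apply: continuous_subspaceT; exact: continuous_pairl.
apply/seteqP; split=> [[x y] /andP[/= xab /le_anti <-]|_ [x + <-]].
  by exists x => //=; rewrite in_itv.
by rewrite /rect /= in_itv /= => ->; rewrite lexx.
Qed.

Lemma connected_vsegment a c d : connected (rect a a c d).
Proof.
suff -> : rect a a c d = (fun y => (a, y)) @` `[c, d].
  apply: connected_continuous_connected; first exact: segment_connected.
  apply: continuous_subspaceT; exact: continuous_pairr.
apply/seteqP; split=> [[x y] /andP[/= /le_anti <- ycd]|_ [y + <-]].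
  by exists y => //=; rewrite in_itv.
by rewrite /rect /= in_itv /= => ->; rewrite lexx.
Qed.

Lemma rect_local (p : R * R) (A : set (R * R)) : nbhs p A -> exists2 e, 0 < e &
  rect (p.1 - e) (p.1 + e) (p.2 - e) (p.2 + e) `<=` A.
Proof.
move=> /nbhs_ballP[e /= e0 eA]; exists (e / 2); first by lra.
move=> q /andP[/andP[h1 h2] /andP[h3 h4]]; apply: eA; split;
  rewrite /ball /= ltr_norml; apply/andP; split; lra.
Qed.

Lemma rectS a b c d a' b' c' d' : a' <= a -> b <= b' -> c' <= c -> d <= d' ->
  rect a b c d `<=` rect a' b' c' d'.
Proof.
by move=> aa bb cc dd p /andP[/andP[? ?] /andP[? ?]];
  do 2 (apply/andP; split); lra.
Qed.

Lemma lift_on_hglue (F : R * R -> circle R) a b c d e : b <= c -> c <= d ->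
  (exists g, lift_on (rect a e b c) F g) ->
  (exists g, lift_on (rect a e c d) F g) ->
  exists g, lift_on (rect a e b d) F g.
Proof.
move=> bc cd l1 l2.
suff [g lg] : exists g, lift_on (rect a e b c `|` rect a e c d) F g.
  exists g; apply: lift_onS lg => p /andP[pa /andP[bp pd]].
  have [pc|/ltW cp] := leP p.2 c; first by left; rewrite /rect /= pa bp.
  by right; rewrite /rect /= pa cp.
apply: lift_on_glue l1 l2; [exact: closed_rect|exact: closed_rect|].
rewrite (_ : _ `&` _ = rect a e c c); first exact: connected_hsegment.
apply/seteqP; split=> p.
  move=> [/andP[pa /andP[_ pc]] /andP[_ /andP[cp _]]].
  by rewrite /rect /= pa cp.
by move=> pc; split; apply: rectS pc.
Qed.

Lemma lift_on_vglue (F : R * R -> circle R) a b c d e : a <= b -> b <= c ->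
  (exists g, lift_on (rect a b d e) F g) ->
  (exists g, lift_on (rect b c d e) F g) ->
  exists g, lift_on (rect a c d e) F g.
Proof.
move=> ab bc l1 l2.
suff [g lg] : exists g, lift_on (rect a b d e `|` rect b c d e) F g.
  exists g; apply: lift_onS lg => p /andP[/andP[ap pc] pd].
  have [pb|/ltW bp] := leP p.1 b; first by left; rewrite /rect /= ap pb.
  by right; rewrite /rect /= bp pc.
apply: lift_on_glue l1 l2; [exact: closed_rect|exact: closed_rect|].
rewrite (_ : _ `&` _ = rect b b d e); first exact: connected_vsegment.
apply/seteqP; split=> p.
  move=> [/andP[/andP[_ pb] pd] /andP[/andP[bp _] _]].
  by rewrite /rect /= pd bp pb.
by move=> pc; split; apply: rectS pc.
Qed.

(** For a fixed abscissa [s], Cousin's lemma along the vertical segment produces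
a lift on a thin strip around it, the width being the least of finitely many.
Cousin's lemma along the horizontal segment then joins the strips. *)
Lemma lift_on_square (F : R * R -> circle R) : coarse F ->
  exists g, lift_on (rect 0 1 0 1) F g.
Proof.
move=> Fc.
apply: (@cousin R (fun u v => exists g, lift_on (rect u v 0 1) F g)).
- exact: ler01.
- move=> u v w uv vw; exact: lift_on_vglue.
move=> s _.
have [d d0 [g lg]] : exists2 d, 0 < d &
    exists g, lift_on (rect (s - d) (s + d) 0 1) F g.
  apply: (@cousin R (fun u v => exists2 d, 0 < d &
    exists g, lift_on (rect (s - d) (s + d) u v) F g)).
  - exact: ler01.
  - move=> u v w uv vw [d1 d10 [g1 lg1]] [d2 d20 [g2 lg2]].
    exists (Num.min d1 d2); first by rewrite lt_min d10.
    have m1 : Num.min d1 d2 <= d1 by rewrite ge_min lexx.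
    have m2 : Num.min d1 d2 <= d2 by rewrite ge_min lexx orbT.
    by apply: (lift_on_hglue uv vw); [exists g1; apply: lift_onS lg1|
      exists g2; apply: lift_onS lg2]; apply: rectS; lra.
  move=> t _; have [g lg] := lift_on_local (s, t) Fc.
  have [d d0 dV] := rect_local (Fc (s, t)).
  exists d => // u v tu ut tv vt; exists d => //; exists g.
  by apply: lift_onS lg; apply: subset_trans dV; apply: rectS => /=; lra.
exists d => // u v su us sv vs; exists g.
by apply: lift_onS lg; apply: rectS; lra.
Qed.

End lifting.

(** * Precision of lifts *)

Section refinement.
Context (R : realType) (T : topologicalType) (F : T -> circle R).
Local Notation proj := (\pi_(circle R)).

(** Near [p], both [g q] and the point over [F q] closest to [g p] are within
[rho] of [g p], so they coincide. Thanks to this a lift built with the single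
bound [rho] has jumps less than [r + e] for each [e > 0] as soon as [F] is
continuous for [c_r]. *)
Lemma lift_on_refine (rho s : R) (D : set T) (g : T -> R) : rho <= 3^-1 ->
  coarse s F -> lift_on rho D F g -> lift_on s D F g.
Proof.
move=> rho_small Fs [gF gc]; split=> // p Dp.
apply: filterS2 (Fs p) (gc p Dp) => q sq + Dq => /(_ Dq) pq.
have [b bq bp] := proj_near (g p) (F q).
have bs : `|b - g p| < rho.
  by rewrite bp -gF // (le_lt_trans (mdist_proj_le _ _)) // distrC.
suff -> : g q = b by rewrite bp gF.
apply: proj_inj_near; first by rewrite gF.
rewrite (_ : g q - b = (g q - g p) - (b - g p)); last by lra.
apply: le_lt_trans (ler_normB _ _) _.
by move: pq bs rho_small; lra.
Qed.

Lemma coarse_lift (s : R) (g : T -> R) : lift_on s setT F g -> coarse s F.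
Proof.
move=> [gF gc] p; apply: filterS (gc p I) => q /(_ I) pq.
by rewrite -!gF // (le_lt_trans (mdist_proj_le _ _)) // distrC.
Qed.

Lemma coarse_comp (s : R) (U : topologicalType) (phi : U -> T) :
  continuous phi -> coarse s F -> coarse s (F \o phi).
Proof. by move=> phic Fs u; exact: phic u _ (Fs (phi u)). Qed.

End refinement.

(** * Continuity into the closure space of the circle *)

Section metric_closure_continuity.
Context (R : realType) (r : R) (r_ge0 : 0 <= r).
Local Notation X := (metric_cspace (circle R) r_ge0).

Lemma metric_cnbhdP (M : metricType R) (x : metric_cspace M r_ge0) U :
  cnbhd x U <-> exists2 e, 0 < e & forall y, mdist (x : M) y < r + e -> U y.
Proof.
split=> [|[e e0 eU] /metric_clP/(_ e e0)[y Uy] /eU//].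
move=> /metric_clP/existsNP[e /not_implyP[e0 ne]]; exists e => // y xy.
by apply: contrapT => Uy; apply: ne; exists y.
Qed.

Lemma ccontinuous_metricP (Y : closureSpace) (f : Y -> X) :
  ccontinuous f <-> forall e, 0 < e ->
    forall y, cnbhd y [set z | mdist (f y : circle R) (f z) < r + e].
Proof.
split=> [/ccontinuousP fc e e0 y|fc].
  by apply: (fc y [set z | mdist (f y : circle R) z < r + e]);
    apply/metric_cnbhdP; exists e.
apply/ccontinuousP => y U /metric_cnbhdP[e e0 eU].
by apply: cnbhdS (fc e e0 y) => z /eU.
Qed.

Lemma topo_ccontinuousP (T : topologicalType) (f : T -> circle R) :
  @ccontinuous (topo_cspace T) X f <-> forall e, 0 < e -> coarse (r + e) f.
Proof.
rewrite ccontinuous_metricP; split=> fc e e0 y; first exact/topo_cnbhdE/fc.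
by apply/topo_cnbhdE; exact: fc.
Qed.

Lemma prod_ccontinuousP (S T : topologicalType) (f : S * T -> circle R) :
  @ccontinuous (prod_cspace (topo_cspace S) (topo_cspace T)) X f <->
  forall e, 0 < e -> coarse (r + e) f.
Proof.
rewrite ccontinuous_metricP; split=> fc e e0 y; first exact/prod_topo_cnbhdE/fc.
by apply/prod_topo_cnbhdE; exact: fc.
Qed.

End metric_closure_continuity.

(** * The winding number *)

Section winding_number.
Context (R : realType) (r : R) (r_ge0 : 0 <= r) (r_lt : r < 3^-1).
Context (x : metric_cspace (circle R) r_ge0).
Local Notation proj := (\pi_(circle R)).
Local Notation itv01 := (itv01 R).
Implicit Types (v w : loop R x) (n m : int).

(** The strict inequality [r < rho] provides an [e > 0] with [r + e = rho]. *)
Let rho : R := (r + 3^-1) / 2.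

Let r_rho : 0 < rho - r.
Proof. by have := r_lt; rewrite /rho; lra. Qed.

Let rho_small : rho <= 3^-1.
Proof. by have := r_lt; rewrite /rho; lra. Qed.

Lemma loop_coarse v e : 0 < e -> coarse (r + e) (v : itv01 -> circle R).
Proof. by move: e; apply/topo_ccontinuousP; exact: loop_ccontinuous. Qed.

Let loop_coarse_rho v : coarse rho (v : itv01 -> circle R).
Proof. by rewrite -[rho](subrKC r); exact: loop_coarse. Qed.

Lemma square_lift (H : itv01 * itv01 -> circle R) : coarse rho H ->
  exists g, lift_on rho setT H g.
Proof.
move=> Hc; pose c (p : R * R) : itv01 * itv01 := (clampI p.1, clampI p.2).
pose i (q : itv01 * itv01) : R * R := (Ival q.1, Ival q.2).
have cc : continuous c.
  by apply: continuous_pair => p; [apply: (continuous_comp cvg_fst)|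
    apply: (continuous_comp cvg_snd)]; exact: clampI_continuous.
have ic : continuous i.
  by apply: continuous_pair => p; [apply: (continuous_comp cvg_fst)|
    apply: (continuous_comp cvg_snd)]; exact: Ival_continuous.
have [g lg] := lift_on_square rho_small (coarse_comp cc Hc).
exists (g \o i).
rewrite (_ : H = (H \o c) \o i); last first.
  by apply/funext => -[s t]; rewrite /c /i /= !clampIK.
by apply: lift_on_comp lg => // q _; rewrite /rect /= !I01.
Qed.

(** A path is lifted as a homotopy that does not depend on its parameter. *)
Lemma path_lift v : exists g, lift_on rho setT (v : itv01 -> circle R) g.
Proof.
have fstc : continuous (fst : itv01 * itv01 -> itv01).
  by move=> p; exact: cvg_fst.
have [g lg] := square_lift (coarse_comp fstc (loop_coarse_rho v)).
exists (g \o (fun t => (t, I0))).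
by apply: (lift_on_comp (@continuous_pairl itv01 itv01 I0) _ lg).
Qed.

Lemma connected_itv01 : connected [set: itv01].
Proof.
rewrite (_ : setT = (@clampI R : R -> itv01) @` `[0, 1]).
  apply: connected_continuous_connected; first exact: segment_connected.
  by apply: continuous_subspaceT; exact: clampI_continuous.
apply/seteqP; split=> // t _; exists (Ival t); last exact: clampIK.
by rewrite /= in_itv /= I01.
Qed.

Lemma lift_increment (F : itv01 -> circle R) g1 g2 :
  lift_on rho setT F g1 -> lift_on rho setT F g2 ->
  forall s t, g1 s - g1 t = g2 s - g2 t.
Proof.
move=> l1 l2 s t.
have := lift_on_unique rho_small connected_itv01 l1 l2 (p := s) (q := t) I I.
lra.
Qed.

(** The winding number as a relation, so that any lift at hand can be used to
compute it. *)
Definition winds v n := exists2 g,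
  lift_on rho setT (v : itv01 -> circle R) g & g I1 - g I0 = n%:~R.

Lemma winds_exists v : exists n, winds v n.
Proof.
have [g lg] := path_lift v.
have /circle_eqP[n gn] : proj (g I1) = proj (g I0).
  by rewrite !(proj1 lg) // loop0 loop1.
by exists n, g.
Qed.

Lemma winds_unique v n m : winds v n -> winds v m -> n = m.
Proof.
move=> [g lg gn] [h lh hm]; apply: (@intr_inj R).
by rewrite -gn -hm; exact: lift_increment lg lh _ _.
Qed.

(** A lift of the homotopy restricts to lifts of both loops. It is constant on
the two sides where the homotopy is, because constant functions are lifts of
constant paths and lifts are unique up to a constant. *)
Lemma winds_homotopic v w n : homotopic v w -> winds v n -> winds w n.
Proof.
move=> [H [/prod_ccontinuousP Hc Hv Hw H0 H1]] [g lg gn].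
have [|K lK] := @square_lift H; first by rewrite -[rho](subrKC r); exact: Hc.
have slice (phi : itv01 -> itv01 * itv01) (F : itv01 -> circle R) :
    continuous phi -> H \o phi = F -> lift_on rho setT F (K \o phi).
  by move=> phic <-; exact: lift_on_comp lK.
have Kv : lift_on rho setT (v : itv01 -> circle R) (fun s => K (s, I0)).
  by apply: (slice _ _ (@continuous_pairl itv01 itv01 I0)); exact/funext.
have Kw : lift_on rho setT (w : itv01 -> circle R) (fun s => K (s, I1)).
  by apply: (slice _ _ (@continuous_pairl itv01 itv01 I1)); exact/funext.
have Kx c : (forall t, H (c, t) = x) -> K (c, I1) = K (c, I0).
  move=> Hx.
  have Kc := slice _ (fun=> x) (@continuous_pairr itv01 itv01 c) (funext Hx).
  apply/eqP; rewrite -subr_eq0; apply/eqP.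
  rewrite (lift_increment Kc (g2 := fun=> repr x)) ?subrr //.
  split=> // [p _|p _]; first by rewrite reprK.
  apply: filterE => q _; rewrite subrr normr0.
  by have := r_rho; have := r_ge0; lra.
exists (fun s => K (s, I1)) => //.
by rewrite Kx // Kx // -gn; exact: lift_increment Kv lg _ _.
Qed.

(** The two halves of a lift of the concatenation, reparametrized, are lifts of
[v] and [w]; their increments add up. *)
Lemma winds_concat v w n m :
  winds v n -> winds w m -> winds (concat v w) (n + m).
Proof.
move=> [gv lv vn] [gw lw wm]; have [g lg] := path_lift (concat v w).
exists g => //.
have half (b : R) :
    continuous (fun t : itv01 => clampI (2^-1 * Ival t + b) : itv01).
  move=> t; apply: continuous_comp; last exact: clampI_continuous.
  exact: (cvgD (cvgM (cvg_cst _) (@Ival_continuous R t)) (cvg_cst _)).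
have lv' : lift_on rho setT (v : itv01 -> circle R)
    (g \o (fun t => clampI (2^-1 * Ival t + 0))).
  rewrite (_ : (v : itv01 -> circle R) =
    concat v w \o (fun t => clampI (2^-1 * Ival t + 0))).
    exact: lift_on_comp lg.
  apply/funext => t; have /andP[t0 t1] := I01 t.
  have u01 : 0 <= 2^-1 * Ival t + 0 <= 1 by apply/andP; split; lra.
  rewrite /= concat_funL IvalK //; last by lra.
  by rewrite addr0 mulVKf ?clampIK // pnatr_eq0.
have lw' : lift_on rho setT (w : itv01 -> circle R)
    (g \o (fun t => clampI (2^-1 * Ival t + 2^-1))).
  rewrite (_ : (w : itv01 -> circle R) =
    concat v w \o (fun t => clampI (2^-1 * Ival t + 2^-1))).
    exact: lift_on_comp lg.
  apply/funext => t; have /andP[t0 t1] := I01 t.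
  have u01 : 0 <= 2^-1 * Ival t + 2^-1 <= 1 by apply/andP; split; lra.
  rewrite /= concat_funR ?loop1 ?loop0 // IvalK //; last by lra.
  by rewrite mulrDr mulVKf ?divff ?addrK ?clampIK // pnatr_eq0.
have := lift_increment lv lv' I1 I0; have := lift_increment lw lw' I1 I0.
rewrite vn wm /= Ival0 Ival1 mulr0 mulr1 !addr0 add0r clampI0.
rewrite (_ : 2^-1 + 2^-1 = 1 :> R) ?clampI1; last by lra.
rewrite intrD => -> ->; lra.
Qed.

Lemma winds_surj n : exists v, winds v n.
Proof.
pose a : R := repr (x : circle R).
pose g (t : itv01) : R := a + n%:~R * Ival t.
have gc : continuous g.
  move=> t.
  exact: (cvgD (cvg_cst _) (cvgM (cvg_cst _) (@Ival_continuous R t))).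
have lg e : 0 < e -> lift_on (r + e) setT (proj \o g) g.
  move=> e0; split=> // p _.
  have re0 : 0 < r + e by rewrite ltr_wpDl.
  by near=> q => _; rewrite distrC; near: q; exact: cvgr_dist_lt (gc p) _ re0.
have vc : @ccontinuous unitI (metric_cspace (circle R) r_ge0) (proj \o g).
  by apply/topo_ccontinuousP => e e0; exact: coarse_lift (lg e e0).
have v0 : (proj \o g) I0 = x by rewrite /= /g Ival0 mulr0 addr0 reprK.
have v1 : (proj \o g) I1 = x by rewrite /= /g Ival1 mulr1 proj_addz reprK.
exists (Loop vc v0 v1), g.
  by rewrite -[rho](subrKC r); exact: lg.
by rewrite /g Ival0 Ival1 mulr0 mulr1 addr0 addrAC subrr add0r.
Unshelve. all: by end_near. Qed.

(** Lifts of [v] and [w] that start at the same point also end at the same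
point. The value of the straight-line homotopy [K] moves by a convex combination of
the moves of the two lifts, less than [r + e / 2], plus a term due to the change
of the deformation parameter, which is small by ordinary continuity. *)
Lemma winds_inj v w n : winds v n -> winds w n -> homotopic v w.
Proof.
move=> [g lg gn] [h' lh' hn'].
have /circle_eqP[k kE] : proj (g I0) = proj (h' I0).
  by rewrite (proj1 lg) // (proj1 lh') // !loop0.
(* The lift of [w] is shifted to start where the lift of [v] does. *)
pose h t := h' t + k%:~R.
have lh : lift_on rho setT (w : itv01 -> circle R) h by exact: lift_on_addz.
have h0 : h I0 = g I0 by rewrite /h -kE addrC subrK.
have h1 : h I1 = g I1 by move: gn hn' kE; rewrite /h; lra.
have fstc : continuous (fst : itv01 * itv01 -> itv01).
  by move=> p; exact: cvg_fst.
pose K (p : itv01 * itv01) : R := (1 - Ival p.2) * g p.1 + Ival p.2 * h p.1.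
have lK e : 0 < e -> lift_on (r + e) setT (proj \o K) K.
  move=> e0; split=> // p _; have e20 : 0 < e / 2 by rewrite divr_gt0.
  have [_ /(_ p I) gc] := lift_on_comp (E := setT) fstc (fun _ _ => I)
    (lift_on_refine rho_small (loop_coarse v e20) lg).
  have [_ /(_ p I) hc] := lift_on_comp (E := setT) fstc (fun _ _ => I)
    (lift_on_refine rho_small (loop_coarse w e20) lh).
  have tp : \forall q \near p,
      `|Ival p.2 * (h p.1 - g p.1) - Ival q.2 * (h p.1 - g p.1)| < e / 2.
    have c2 : continuous (fun q : itv01 * itv01 => Ival q.2 * (h p.1 - g p.1)).
      move=> q; apply: cvgM; last exact: cvg_cst.
      by apply: continuous_comp; [exact: cvg_snd|exact: Ival_continuous].
    exact: cvgr_dist_lt (c2 p) _ e20.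
  apply: filterS3 gc hc tp => q /(_ I) + /(_ I) + + _ /=.
  have /andP[t0 t1] := I01 q.2; have t1' : 0 <= 1 - Ival q.2 by lra.
  rewrite /K /comp !ltr_norml => /andP[/ltW g1 /ltW g2] /andP[/ltW k1 /ltW k2].
  have {g1 g2} := (ler_wpM2l t1' g1, ler_wpM2l t1' g2).
  have {k1 k2} := (ler_wpM2l t0 k1, ler_wpM2l t0 k2).
  by move=> [k1 k2] [g1 g2] /andP[? ?]; apply/andP; split; lra.
exists (proj \o K); split.
- by apply/prod_ccontinuousP => e e0; exact: coarse_lift (lK e e0).
- by move=> s; rewrite /= /K Ival0 subr0 mul1r mul0r addr0 (proj1 lg).
- by move=> s; rewrite /= /K Ival1 subrr mul1r mul0r add0r (proj1 lh).
- by move=> t; rewrite /= /K h0 -mulrDl subrK mul1r (proj1 lg) // loop0.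
- by move=> t; rewrite /= /K h1 -mulrDl subrK mul1r (proj1 lg) // loop1.
Qed.

End winding_number.

Theorem theorem4p48 (R : realType) (r : R) (r_ge0 : 0 <= r) (r_lt : r < 3^-1)
    (x : metric_cspace (circle R) r_ge0) :
  exists f : pi1 R x -> int,
    bijective f /\ {morph f : a b / (a * b)%g >-> a + b}.
Proof.
have /choice[deg degP] (v : loop R x) : exists n, winds v n.
  exact: winds_exists.
have /choice[u uP] (n : int) : exists v : loop R x, winds v n.
  exact: winds_surj.
have deg_eq v w : \pi_(pi1 R x) v = \pi_(pi1 R x) w <-> deg v = deg w.
  rewrite pi1_eqP; split=> [vw|vw].
    by apply: (winds_unique r_lt (v := w)) => //; exact: winds_homotopic vw _.
  by apply: (winds_inj r_lt (n := deg v)) => //; rewrite vw.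
pose f (a : pi1 R x) := deg (repr a).
have fpi v : f (\pi_(pi1 R x) v) = deg v.
  by apply/deg_eq; rewrite reprK.
exists f; split.
  exists (fun n => \pi_(pi1 R x) (u n)) => [a|n].
    rewrite -[RHS]reprK; apply/deg_eq.
    exact: (winds_unique r_lt (v := u (f a))).
  by rewrite fpi; exact: (winds_unique r_lt (v := u n)).
move=> a b; rewrite -[a]reprK -[b]reprK.
have -> : (\pi_(pi1 R x) (repr a) * \pi_(pi1 R x) (repr b))%g =
    \pi_(pi1 R x) (concat (repr a) (repr b)) by exact: pi1_mul_pi.
rewrite !fpi; apply: (winds_unique r_lt (v := concat (repr a) (repr b))) => //.
exact: winds_concat.
Qed.
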